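(* Let $Z$ be the twistor space of the flat metric on $\mathbb R^4$, i.e. the total space of $\mathcal O(1)\oplus\mathcal O(1)$ over $\mathbb P^1$, and let $\pi:Z\to|\mathcal O(2)|$ be the projection given by fibrewise multiplication $\pi(x,y)=xy$. Then the space $p:Z^{[n]}_\pi\to\mathbb P^1$, obtained by applying the transverse Hilbert scheme construction for $n$ points fibrewise over $\mathbb P^1$, has no sections; in particular it has no twistor lines, and this construction does not produce new hyperkähler metrics.
   Context: $|\mathcal O(2)|$ denotes the total space of the line bundle $\mathcal O(2)$ over $\mathbb P^1$. For a complex manifold $X$ with a surjective holomorphic map $\pi:X\to C$ to a $1$-dimensional complex manifold, the transverse Hilbert scheme $X^{[n]}_\pi$ is the open subset of the Hilbert scheme $X^{[n]}$ of $n$ points in $X$ consisting of those $0$-dimensional subschemes of length $n$ which are mapped isomorphically by $\pi$ onto their scheme-theoretic image. $Z^{[n]}_\pi$ is the union over $\zeta\in\mathbb P^1$ of the transverse Hilbert schemes $(Z_\zeta)^{[n]}_{\pi_\zeta}$ of the fibres $Z_\zeta\simeq\mathbb C^2$ of $Z\to\mathbb P^1$, with respect to the restriction $\pi_\zeta:Z_\zeta\to|\mathcal O(2)|_\zeta\simeq\mathbb C$ of $\pi$; $p$ is the induced projection to $\mathbb P^1$. Sections are holomorphic sections of $p$; twistor lines are sections invariant under the induced real structure and with normal bundle a direct sum of copies of $\mathcal O(1)$.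
   Formalization: The formal theorem assumes n ≥ 2: for n = 1 the space is Z itself, whose zero section is a twistor line, and for n = 0 it is P^1 with its identity section, so the claim fails exactly in those cases. *)

(* Defs.v *)
From HB Require Import structures.
From mathcomp Require Import all_boot all_order all_algebra.
From mathcomp Require Import complex.
From mathcomp Require Import boolp classical_sets reals topology normedtype derive.
Set Implicit Arguments.
Unset Strict Implicit.
Unset Printing Implicit Defensive.
Import Order.TTheory GRing.Theory Num.Theory.
Import numFieldNormedType.Exports.
Local Open Scope ring_scope.
Local Open Scope classical_set_scope.

(* The complex field, typed as a numClosedFieldType so that it carries the
   norm topology: [derivable f t 1] below is complex differentiability. *)
Definition Cplx (R : realType) : numClosedFieldType := R[i].

(** * The Hilbert scheme of n points of C^2 *)

(* C[x, y], with x = 'X and y = 'Y. *)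
Definition Cxy (R : realType) : comNzRingType := {poly {poly Cplx R}}.

Definition cst (R : realType) (c : Cplx R) : Cxy R := c%:P%:P.
Definition vx (R : realType) : Cxy R := 'X.
Definition vy (R : realType) : Cxy R := 'Y.
Definition mon (R : realType) (m : nat * nat) : Cxy R := vx R ^+ m.1 * vy R ^+ m.2.

(* f(g, h) *)
Definition subst2 (R : realType) (f g h : Cxy R) : Cxy R :=
  (map_poly (fun q : {poly Cplx R} => (map_poly (@cst R) q).[h]) f).[g].

(* The comorphism C[z] -> C[x, y], g |-> g(p), of p : C^2 -> C. *)
Definition pullback (R : realType) (p : Cxy R) (g : {poly Cplx R}) : Cxy R :=
  (map_poly (@cst R) g).[p].

Definition is_ideal (R : realType) (I : set (Cxy R)) : Prop :=
  [/\ I 0, (forall f g, I f -> I g -> I (f + g))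
    & (forall a f, I f -> I (a * f))].

Definition lincomb (R : realType) n (c : {ffun 'I_n -> Cplx R})
  (b : 'I_n -> Cxy R) : Cxy R := \sum_(i < n) cst (c i) * b i.

(* The classes of b_0, ..., b_{n-1} form a C-basis of C[x, y] / I. *)
Definition basis_mod (R : realType) n (I : set (Cxy R)) (b : 'I_n -> Cxy R) : Prop :=
  forall f, exists! c : {ffun 'I_n -> Cplx R}, I (f - lincomb c b).

(* Closed subschemes of C^2 of length n, as ideals of colength n. *)
Definition Hilb (R : realType) n : set (set (Cxy R)) :=
  [set I | is_ideal I /\ exists b : 'I_n -> Cxy R, basis_mod I b].

(* Ideal of the scheme-theoretic image of V(I) under p. *)
Definition scheme_image (R : realType) (p : Cxy R) (I : set (Cxy R)) :
    set {poly Cplx R} :=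
  [set g | I (pullback p g)].

(* V(I) -> p(V(I)) is an isomorphism: the induced map
   C[z] / scheme_image p I -> C[x, y] / I is bijective. *)
Definition transverse (R : realType) (p : Cxy R) (I : set (Cxy R)) : Prop :=
  forall f, exists g, I (f - pullback p g) /\
    forall h, I (f - pullback p h) -> scheme_image p I (g - h).

Definition tHilb (R : realType) n (p : Cxy R) : set (set (Cxy R)) :=
  [set I | Hilb n I /\ transverse p I].

(* Coefficients of the class of f in the basis b of C[x, y] / I. *)
Definition coord (R : realType) n (I : set (Cxy R)) (b : 'I_n -> Cxy R)
    (f : Cxy R) : {ffun 'I_n -> Cplx R} :=
  xget 0 [set c : {ffun 'I_n -> Cplx R} | I (f - lincomb c b)].

(* Complex structure of the Hilbert scheme: an n-tuple b of monomials defines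
   the affine open subset U_b of the ideals modulo which b is a basis, and the
   coordinate ring of U_b is generated by the functions sending I to the
   coefficients of the monomials in the basis b of C[x, y] / I; the U_b cover.
   Hence F : C -> Hilb is holomorphic iff near every point it takes its values
   in some U_b and its composites with these functions are holomorphic. *)
Definition holo_curve (R : realType) n (F : Cplx R -> set (Cxy R)) : Prop :=
  forall t0 : Cplx R, exists e : 'I_n -> nat * nat, \forall t \near t0,
    basis_mod (F t) (@mon R \o e) /\
    forall m i, derivable (fun u => coord (F u) (@mon R \o e) (mon R m) i) t 1.

(** * The tangent bundle of the Hilbert scheme *)

(* The tangent space at I is Hom_{C[x, y]}(I, C[x, y] / I).  An element is
   represented by a map of representatives, relevant on I and modulo I. *)
Definition tangent (R : realType) (I : set (Cxy R)) (phi : Cxy R -> Cxy R) : Prop :=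
  (forall f g, I f -> I g -> I (phi (f + g) - (phi f + phi g))) /\
  (forall a f, I f -> I (phi (a * f) - a * phi f)).

Definition tangent_basis (R : realType) r (I : set (Cxy R))
    (Phi : 'I_r -> Cxy R -> Cxy R) : Prop :=
  (forall k, tangent I (Phi k)) /\
  forall psi, tangent I psi -> exists! c : {ffun 'I_r -> Cplx R},
    forall f, I f -> I (psi f - lincomb c (Phi^~ f)).

(* In U_b, the components of phi in T_I are, up to sign, the coefficients of
   phi (m - sum_i c_i b_i), where m is a monomial and sum_i c_i b_i its
   expansion modulo I. *)
Definition holo_field (R : realType) n (F : Cplx R -> set (Cxy R))
    (phi : Cplx R -> Cxy R -> Cxy R) : Prop :=
  forall t0 : Cplx R, exists e : 'I_n -> nat * nat, let b := @mon R \o e in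
    \forall t \near t0, basis_mod (F t) b /\
    forall m i, derivable (fun u =>
      coord (F u) b (phi u (mon R m - lincomb (coord (F u) b (mon R m)) b)) i) t 1.

(** * The projective line, O(k) and the twistor space Z *)

(* Some z is the point of affine coordinate z, None is infinity. *)
Definition P1 (R : realType) : Type := option (Cplx R).

(* The two standard charts: chart [false] has coordinate z, chart [true] has
   coordinate 1/z.  [pt j t] is the point of coordinate t in chart j. *)
Definition pt (R : realType) (j : bool) (t : Cplx R) : P1 R :=
  if j then (if t == 0 then None else Some t^-1) else Some t.

(* The fibre of O(k) over zeta is identified with C by the trivialisation over
   chart [false] if zeta is finite, and over chart [true] if zeta is infinity.
   An element v of the fibre then has coordinate [tr k j zeta * v] in the
   trivialisation over chart j (if j contains zeta): v' = v / z^k. *)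
Definition tr (R : realType) (k : nat) (j : bool) (zeta : P1 R) : Cplx R :=
  if zeta is Some z then (if j then z ^- k else 1) else 1.

Definition totO (R : realType) (k : nat) : Type := (P1 R * Cplx R)%type.
Definition Ztw (R : realType) : Type := (P1 R * (Cplx R * Cplx R))%type.

Definition piZ (R : realType) (w : Ztw R) : totO R 2 := (w.1, w.2.1 * w.2.2).

(* In the trivialisations over either chart, pi is (x, y) |-> x y. *)
Lemma piZ_chart (R : realType) (j : bool) (w : Ztw R) :
  tr 2 j (piZ w).1 * (piZ w).2 = (tr 1 j w.1 * w.2.1) * (tr 1 j w.1 * w.2.2).
Proof.
rewrite mulrACA; congr (_ * _); case: w => -[z|] v //=; last by rewrite mulr1.
by case: j; rewrite ?mulr1 // expr1 -expr2 exprVn.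
Qed.

(* The restriction of pi to a fibre of Z, as a polynomial. *)
Definition pi_fib (R : realType) : Cxy R := vx R * vy R.

(** * The fibrewise transverse Hilbert scheme and its sections *)

(* Ambient set of Z^[n]_pi: a point of P^1 and a subscheme of the fibre. *)
Definition fibsub (R : realType) : Type := (P1 R * set (Cxy R))%type.

Definition Zn (R : realType) n : set (fibsub R) :=
  [set w | tHilb n (pi_fib R) w.2].

Definition pZn (R : realType) (w : fibsub R) : P1 R := w.1.

(* The pullback of functions along (x, y) |-> (a x, a y). *)
Definition rescale (R : realType) (a : Cplx R) (f : Cxy R) : Cxy R :=
  subst2 f (cst a * vx R) (cst a * vy R).

(* The subscheme w in the coordinates of Z over chart j. *)
Definition chart_ideal (R : realType) (j : bool) (w : fibsub R) : set (Cxy R) :=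
  [set f | w.2 (rescale (tr 1 j w.1) f)].

Definition in_chart (R : realType) (s : P1 R -> fibsub R) (j : bool)
  (t : Cplx R) : set (Cxy R) := chart_ideal j (s (pt j t)).

Definition holo_section (R : realType) n (s : P1 R -> fibsub R) : Prop :=
  [/\ forall zeta, Zn n (s zeta), forall zeta, pZn (s zeta) = zeta
    & forall j, holo_curve n (in_chart s j)].

(** * Twistor lines *)

Definition antipode (R : realType) (zeta : P1 R) : P1 R :=
  if zeta is Some z then (if z == 0 then None else Some (- (z^*)^-1)) else Some 0.

(* Writing z~ for the conjugate of z, the real structure of Z is
   (z, x, y) |-> (- 1 / z~, - y~ / z~, x~ / z~), that is (- z~, y~, - x~) in
   the target coordinates over chart [true].  In the identifications of the
   fibres with C^2 made above, it is (x, y) |-> (a y~, - a x~), a as follows. *)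
Definition sigma_coef (R : realType) (zeta : P1 R) : Cplx R :=
  if zeta is Some z then (if z == 0 then 1 else - (z^*)^-1) else -1.

Definition sigmaZ (R : realType) (w : Ztw R) : Ztw R :=
  let a := sigma_coef w.1 in
  (antipode w.1, (a * (w.2.2)^*, - (a * (w.2.1)^*))).

Lemma sigmaZK (R : realType) : involutive (@sigmaZ R).
Proof.
case=> -[z|] [x y]; rewrite /sigmaZ /=; last first.
  by rewrite eqxx rmorphN !rmorphM !rmorphN /= !rmorph1 !conjCK !mul1r !mulN1r !opprK.
have [->|z0] := eqVneq z 0.
  by rewrite rmorphN !rmorphM /= !rmorph1 !conjCK !mul1r !mulN1r !opprK.
rewrite /antipode /sigma_coef oppr_eq0 invr_eq0 conjC_eq0 (negPf z0).
rewrite !(rmorphN, rmorphM, fmorphV) /= !conjCK !invrN !invrK !opprK.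
by rewrite !mulNr !mulrN !opprK !mulVKf.
Qed.

(* The image of a subscheme under sigmaZ: f vanishes on it iff the conjugate of
   f \o sigmaZ vanishes on the original one. *)
Definition sigmaZn (R : realType) (w : fibsub R) : fibsub R :=
  let a := (sigma_coef w.1)^* in
  (antipode w.1,
   [set f | w.2 (subst2 (map_poly (map_poly Num.conj) f)
                        (cst a * vy R) (- (cst a * vx R)))]).

Definition real_section (R : realType) (s : P1 R -> fibsub R) : Prop :=
  forall zeta, s (antipode zeta) = sigmaZn (s zeta).

(* The normal bundle of the image of s is the pullback by s of the vertical
   tangent bundle of Z^[n]_pi.  It is isomorphic to O(1)^r iff it has
   holomorphic frames over the two charts which are related as those of O(1):
   the frame over chart [true] is z times the frame over chart [false].
   [rescale z^-1] goes from functions in the coordinates over chart [true] to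
   functions in the coordinates over chart [false]. *)
Definition normal_O1 (R : realType) n (s : P1 R -> fibsub R) : Prop :=
  exists r (Phi : bool -> 'I_r -> Cplx R -> Cxy R -> Cxy R),
  [/\ forall j t, tangent_basis (in_chart s j t) (fun k => Phi j k t),
      forall j k, holo_field n (in_chart s j) (Phi j k)
    & forall k z f, z != 0 -> in_chart s true z^-1 f ->
        in_chart s false z (rescale z^-1 (Phi true k z^-1 f)
                            - cst z * Phi false k z (rescale z^-1 f))].

(* The space on which the twistor construction yields a hyperkaehler metric. *)
Definition twistor_lines (R : realType) n : set (P1 R -> fibsub R) :=
  [set s | [/\ holo_section n s, real_section s & normal_O1 n s]].
Arguments twistor_lines : clear implicits.

(* Main.v *)
From HB Require Import structures.
Require Import Defs.
From mathcomp Require Import all_boot all_order all_algebra.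
From mathcomp Require Import complex ring.
From mathcomp Require Import boolp classical_sets reals.
From mathcomp Require Import topology normedtype landau derive.
Set Implicit Arguments.
Unset Strict Implicit.
Unset Printing Implicit Defensive.
Import Order.TTheory GRing.Theory Num.Theory.
Import numFieldNormedType.Exports.
Import Defs.
Local Open Scope ring_scope.
Local Open Scope classical_set_scope.

(** A transverse subscheme of length n of C^2, with respect to z = x y, is the
spectrum of C[z]/(q) for a monic q of degree n, together with two polynomials
of degree < n giving x and y on it; so the powers of z of exponent < n are a
basis of its functions ([transverse_diag_basis]), and x = sum_k a_k z^k.  Along
a section, each a_k is a holomorphic function in either chart of P^1
([holo_curve_coord]).  As x and y have weight 1 and z has weight 2, a_k is a
section of O(1 - 2k) ([rescale_coord]), and so is the coefficient b_k of z^k in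
y.  For k >= 1 these bundles are negative, so a_k and b_k vanish
([no_section_negative_degree]).  Then x and y are constants on the subscheme,
hence so is z = x y, whereas 1 and z are linearly independent on it when
n >= 2.  It is enough to see this over one point of P^1, the origin of chart
[true].

The analytic input is that a pair of entire functions F, G with
G(1/z) = z^(m+1) F(z) satisfies G(0) = 0.  Replacing F by z^m F reduces to
m = 0; then z F(z) tends to G(0) at infinity, so the integral of F over the
boundary of a large square tends to 2 pi i G(0), while it is zero by Goursat's
theorem ([goursat]).  Only two facts about contour integrals matter: they are
additive under subdivision of squares, and they vanish on affine functions.
Dyadic midpoint sums have both exactly, so they stand in for the integrals. *)

(** * Midpoint sums along edges and squares *)

Section LoopSums.
Variable C : numClosedFieldType.
Implicit Types (f g : C -> C) (a v h p : C).

(** The composite midpoint rule with 2^N equal steps for the integral of f along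
the segment from a to a + v.  The recursion makes additivity under halving
definitional. *)
Fixpoint edge_sum (N : nat) f a v : C :=
  if N is M.+1 then edge_sum M f a (v / 2) + edge_sum M f (a + v / 2) (v / 2)
  else v * f (a + v / 2).

(** The counterclockwise boundary of the square with corners a, a + h,
a + h + 'i h and a + 'i h. *)
Definition loop_sum (N : nat) f a h : C :=
  edge_sum N f a h + edge_sum N f (a + h) ('i * h)
  - edge_sum N f (a + 'i * h) h - edge_sum N f a ('i * h).

Lemma half_itv (s : C) : 0 <= s <= 1 ->
  (0 <= s / 2 <= 1) /\ (0 <= (1 + s) / 2 <= 1).
Proof.
move=> /andP[s0 s1]; split; apply/andP; split.
- by rewrite divr_ge0.
- by rewrite ler_pdivrMr // mul1r (le_trans s1) // ler1n.
- by rewrite divr_ge0 // addr_ge0.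
- by rewrite ler_pdivrMr // mul1r -[leRHS]/(1 + 1) lerD2l.
Qed.

(** Convexity of discs: the sum is an average of values of v f on the segment.
With p = 0 this is the usual length times supremum bound; with other p it
localizes the sum. *)
Lemma edge_sum_close N f a v p B :
  (forall s, 0 <= s <= 1 -> `|v * f (a + s * v) - p| <= B) ->
  `|edge_sum N f a v - p| <= B.
Proof.
elim: N a v p B => [|N IH] a v p B H /=.
  have /H : 0 <= (2^-1 : C) <= 1 by rewrite invr_ge0 ler0n /= invf_le1 ?ler1n.
  by rewrite [_^-1 * v]mulrC.
have -> : B = B / 2 + B / 2 by field.
have -> : edge_sum N f a (v / 2) + edge_sum N f (a + v / 2) (v / 2) - p =
  (edge_sum N f a (v / 2) - p / 2) + (edge_sum N f (a + v / 2) (v / 2) - p / 2).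
  by field.
have half w : `|w - p| <= B -> `|w / 2 - p / 2| <= B / 2.
  by move=> ?; rewrite -mulrBl normrM normfV normr_nat ler_wpM2r ?invr_ge0.
rewrite (le_trans (ler_normD _ _)) // lerD //; apply: IH => s /half_itv[s1 s2].
  have /half := H _ s1; congr (_ <= _); congr `|_ - _|.
  by rewrite mulrAC; congr (_ * f (_ + _)); field.
have /half := H _ s2; congr (_ <= _); congr `|_ - _|.
by rewrite mulrAC; congr (_ * f _); field.
Qed.

Lemma edge_sumB N f g a v :
  edge_sum N (fun z => f z - g z) a v = edge_sum N f a v - edge_sum N g a v.
Proof.
by elim: N a v => [|N IH] a v /=; rewrite ?mulrBr // !IH; ring.
Qed.

(** The midpoint rule is exact on affine functions, so their sum over a closed
loop is zero at every N. *)
Lemma edge_sum_affine N (al be w : C) a v :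
  edge_sum N (fun z => al + be * (z - w)) a v = v * (al + be * (a + v / 2 - w)).
Proof.
by elim: N a v => [|N IH] a v //=; rewrite !IH; field.
Qed.

(** In the sum over the four quarters of a square, the inner edges cancel in
pairs. *)
Lemma loop_sumS N f a h : loop_sum N.+1 f a h =
  loop_sum N f a (h / 2) + loop_sum N f (a + h / 2) (h / 2)
  + (loop_sum N f (a + 'i * (h / 2)) (h / 2)
     + loop_sum N f (a + h / 2 + 'i * (h / 2)) (h / 2)).
Proof.
rewrite /loop_sum /= -!mulrA.
have -> : a + h / 2 + h / 2 = a + h by field.
have -> : a + 'i * (h / 2) + 'i * (h / 2) = a + 'i * h by field.
have -> : a + 'i * (h / 2) + h / 2 = a + h / 2 + 'i * (h / 2) by ring.
have -> : a + h / 2 + 'i * (h / 2) + h / 2 = a + h + 'i * (h / 2) by field.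
have -> : a + h / 2 + 'i * (h / 2) + 'i * (h / 2) = a + 'i * h + h / 2 by field.
ring.
Qed.

Definition in_square a h (w : C) := exists s t : C,
  [/\ 0 <= s <= 1, 0 <= t <= 1 & w = a + s * h + t * ('i * h)].

Lemma loop_sum_affine_close N f (al be z : C) a h B :
  (forall w, in_square a h w -> `|f w - (al + be * (w - z))| <= B) ->
  `|loop_sum N f a h| <= 4 * (`|h| * B).
Proof.
move=> H; pose L w := al + be * (w - z).
have -> : loop_sum N f a h = loop_sum N (fun w => f w - L w) a h.
  have L0 : loop_sum N L a h = 0 by rewrite /loop_sum !edge_sum_affine; field.
  by rewrite -[LHS]subr0 -L0 /loop_sum !edge_sumB; ring.
have E b v : `|v| = `|h| -> (forall s, 0 <= s <= 1 -> in_square a h (b + s * v)) ->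
    `|edge_sum N (fun w => f w - L w) b v| <= `|h| * B.
  move=> vh Hin; rewrite -[edge_sum _ _ _ _]subr0; apply: edge_sum_close => s s01.
  by rewrite subr0 normrM vh ler_wpM2l // H //; apply: Hin.
have ih : `|'i * h| = `|h| by rewrite normrM normCi mul1r.
rewrite /loop_sum (_ : 4 * _ = `|h| * B + `|h| * B + `|h| * B + `|h| * B); last by ring.
have z01 : 0 <= (0 : C) <= 1 by rewrite lexx ler01.
have o01 : 0 <= (1 : C) <= 1 by rewrite lexx ler01.
rewrite (le_trans (ler_normB _ _)) // lerD //; last first.
  by apply: E => // s s01; exists 0, s; split => //; ring.
rewrite (le_trans (ler_normB _ _)) // lerD //; last first.
  by apply: E => // s s01; exists s, 1; split => //; ring.
rewrite (le_trans (ler_normD _ _)) // lerD //.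
  by apply: E => // s s01; exists s, 0; split => //; ring.
by apply: E => // s s01; exists 1, s; split => //; ring.
Qed.

(** The bound is proportional to the area of the square, so that the bounds on
the four quarters add up to the bound on the whole. *)
Definition negligible_loop e f a h :=
  exists N0 : nat, forall N, (N0 <= N)%N -> `|loop_sum N f a h| <= e * `|h| ^+ 2.

Lemma negligible_loop_quarter e f a h :
  (forall d : bool * bool, negligible_loop e f
     (a + d.1%:R * (h / 2) + d.2%:R * ('i * (h / 2))) (h / 2)) ->
  negligible_loop e f a h.
Proof.
move=> H.
have [N1 H1] := H (false, false); have [N2 H2] := H (true, false).
have [N3 H3] := H (false, true); have [N4 H4] := H (true, true).
exists (maxn (maxn N1 N2) (maxn N3 N4)).+1 => -[|N] //.
rewrite ltnS !geq_max => /andP[/andP[n1 n2] /andP[n3 n4]].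
rewrite loop_sumS.
move: (H1 N n1) (H2 N n2) (H3 N n3) (H4 N n4) => /=.
rewrite !mul1r !mul0r !addr0 normrM normfV normr_nat exprMn => h1 h2 h3 h4.
have -> : e * `|h| ^+ 2 =
  (e * (`|h| ^+ 2 * (2^-1) ^+ 2) + e * (`|h| ^+ 2 * (2^-1) ^+ 2)) +
  (e * (`|h| ^+ 2 * (2^-1) ^+ 2) + e * (`|h| ^+ 2 * (2^-1) ^+ 2)).
  by field.
rewrite (le_trans (ler_normD _ _)) // lerD //.
  by rewrite (le_trans (ler_normD _ _)) // lerD.
by rewrite (le_trans (ler_normD _ _)) // lerD.
Qed.

End LoopSums.

(** * Differentiability of determinants and inverses *)

Section HolomorphicMatrices.
Variable K : numFieldType.

Lemma derivable_mul (f g : K -> K) t :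
  derivable f t 1 -> derivable g t 1 -> derivable (fun u => f u * g u) t 1.
Proof. by move=> df dg; exact: (@derivableM K K f g t 1 df dg). Qed.

Lemma derivable_bigsum (J : Type) (r : seq J) (P : pred J) (f : J -> K -> K) t :
  (forall i, derivable (f i) t 1) ->
  derivable (fun u => \sum_(i <- r | P i) f i u) t 1.
Proof.
move=> df; elim: r => [|i r IH].
  under eq_fun do rewrite big_nil; exact: derivable_cst.
under eq_fun do rewrite big_cons; case: (P i) => //; exact: derivableD.
Qed.

Lemma derivable_bigprod (J : Type) (r : seq J) (P : pred J) (f : J -> K -> K) t :
  (forall i, derivable (f i) t 1) ->
  derivable (fun u => \prod_(i <- r | P i) f i u) t 1.
Proof.
move=> df; elim: r => [|i r IH].
  under eq_fun do rewrite big_nil; exact: derivable_cst.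
under eq_fun do rewrite big_cons; case: (P i) => //; exact: derivable_mul.
Qed.

Lemma derivable_det n (A : K -> 'M[K]_n) t :
  (forall i j, derivable (fun u => A u i j) t 1) ->
  derivable (fun u => \det (A u)) t 1.
Proof.
move=> dA; apply: derivable_bigsum => p; apply: derivable_mul.
  exact: derivable_cst.
exact: derivable_bigprod.
Qed.

Lemma derivable_invmx n (A : K -> 'M[K]_n) t :
  (\forall u \near t, A u \in unitmx) ->
  (forall i j, derivable (fun u => A u i j) t 1) ->
  forall i j, derivable (fun u => invmx (A u) i j) t 1.
Proof.
move=> uA dA i j.
have d0 : \det (A t) != 0 by have := nbhs_singleton uA; rewrite unitmxE unitfE.
apply: (@near_eq_derivable _ _ _ (fun u => (\det (A u))^-1 * cofactor (A u) j i)).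
  by near=> u; rewrite /invmx ifT ?mxE //; near: u.
apply: derivable_mul; first by apply: derivableV => //; exact: derivable_det.
apply: derivable_mul; first exact: derivable_cst.
apply: derivable_det => k l; under eq_fun do rewrite !mxE; exact: dA.
Unshelve. all: by end_near. Qed.

End HolomorphicMatrices.

(** * Goursat's theorem and sections of negative line bundles *)

Section Goursat.
Variable R : realType.
Local Notation C := (Cplx R).
Local Open Scope complex_scope.

(** Radii of discs in C are positive complex numbers; a real radius gives access
to the Archimedean property. *)
Lemma near_closed_disc (P : C -> Prop) (z : C) : (\forall w \near z, P w) ->
  exists r : R, 0 < r /\ forall w, `|w - z| <= r%:C -> P w.
Proof.
move=> /nbhs_ballP[/= d d0 H].
have dR : d = (complex.Re d)%:C by rewrite RRe_real // gtr0_real.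
have Rd0 : 0 < complex.Re d by move: d0; rewrite {1}dR ltcR.
exists (complex.Re d / 2); split=> [|w wz]; first by rewrite divr_gt0.
apply: H; rewrite -ball_normE /= distrC (le_lt_trans wz) // dR ltcR.
by rewrite ltr_pdivrMr // mulr_natr mulr2n ltrDl.
Qed.

Lemma derivable_affine_approx (f : C -> C) (z : C) : derivable f z 1 ->
  exists d : C, forall e : C, 0 < e -> exists r : R, 0 < r /\
    forall w, `|w - z| <= r%:C -> `|f w - (f z + d * (w - z))| <= e * `|w - z|.
Proof.
move=> /derivable_nbhs df; exists ('D_1 f z) => e e0.
move: df => /eqaddoP /(_ e e0) /near_closed_disc[r [r0 H]].
exists r; split=> // w wz; have := H (w - z); rewrite subr0 => /(_ wz).
congr (`|_| <= _).
change (f ((w - z) * 1 + z) - (f z + (w - z) * 'D_1 f z) =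
  f w - (f z + 'D_1 f z * (w - z))).
by rewrite mulr1 subrK [_ * 'D_1 f z]mulrC.
Qed.

(** The left ends of nested intervals, each one half of the previous one, have a
supremum lying in all of them. *)
Lemma nested_halving (x : nat -> R) (r : R) : 0 <= r ->
  (forall k, x k <= x k.+1 <= x k + r / 2 ^+ k.+1) ->
  exists X, forall k, x k <= X <= x k + r / 2 ^+ k.
Proof.
move=> r0 H.
have inc k j : x k <= x (k + j)%N.
  elim: j => [|j IH]; rewrite ?addn0 // addnS (le_trans IH) //.
  by case/andP: (H (k + j)%N).
have dec k j : x (k + j)%N + r / 2 ^+ (k + j) <= x k + r / 2 ^+ k.
  elim: j => [|j IH]; rewrite ?addn0 // addnS (le_trans _ IH) //.
  have /andP[_ h] := H (k + j)%N.
  have -> : r / 2 ^+ (k + j) = r / 2 ^+ (k + j).+1 + r / 2 ^+ (k + j).+1.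
    by rewrite exprS; field; rewrite expf_neq0 // pnatr_eq0.
  by rewrite addrA lerD2r.
have ub k j : x j <= x k + r / 2 ^+ k.
  have [kj|jk] := leqP k j.
    rewrite -(subnKC kj) (le_trans _ (dec k (j - k)%N)) // lerDl.
    by rewrite divr_ge0 // exprn_ge0.
  rewrite (le_trans (inc j (k - j)%N)) // subnKC 1?ltnW // lerDl.
  by rewrite divr_ge0 // exprn_ge0.
exists (sup (range x)) => k; apply/andP; split.
  by apply: ub_le_sup; [exists (x 0%N + r / 2 ^+ 0) => _ [j _ <-]|exists k].
by apply: ge_sup; [exists (x 0%N); exists 0%N | move=> _ [j _ <-]].
Qed.

(** If the loop sums around some square did not become small, compared to its
area, then the same would be true of one of its quarters, and so on.  The
nested squares shrink to a point, near which f is affine up to an error that is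
small compared to the size of the square; as affine functions have zero loop
sums, the loop sum around a small square is small compared to its area. *)
Theorem goursat (f : C -> C) : (forall z, derivable f z 1) ->
  forall (a : C) (r : R), 0 < r -> forall e : C, 0 < e ->
  exists N0 : nat, forall N, (N0 <= N)%N -> `|loop_sum N f a r%:C| <= e.
Proof.
move=> df a r r0 e1 e10.
have rC k : `|(r / 2 ^+ k)%:C| = (r / 2 ^+ k)%:C :> C.
  by rewrite ger0_norm // lecR divr_ge0 ?exprn_ge0 // ltW.
have rC0 : 0 < (r%:C : C) by rewrite ltcR.
set e : C := e1 / r%:C ^+ 2.
have e0 : 0 < e by rewrite divr_gt0 // exprn_gt0.
suff : negligible_loop e f a r%:C.
  case=> N0 H; exists N0 => N /H; rewrite (ger0_norm (ltW rC0)) /e divfK //.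
  by rewrite expf_neq0 // gt_eqF.
apply: contrapT => nH0.
(* the choice of a bad quarter of a bad square *)
have [nx nxP] : exists nx : C -> R -> bool * bool, forall a h,
    ~ negligible_loop e f a h%:C ->
    ~ negligible_loop e f (a + (nx a h).1%:R * (h%:C / 2)
        + (nx a h).2%:R * ('i%R * (h%:C / 2))) (h%:C / 2).
  have : forall p : C * R, exists d : bool * bool,
      ~ negligible_loop e f p.1 p.2%:C ->
      ~ negligible_loop e f (p.1 + d.1%:R * (p.2%:C / 2)
        + d.2%:R * ('i%R * (p.2%:C / 2))) (p.2%:C / 2).
    move=> p; apply: contrapT => /forallNP H.
    have nH : ~ negligible_loop e f p.1 p.2%:C.
      by move=> n; apply: (H (true, true)).
    apply: nH; apply: negligible_loop_quarter => d.
    by apply: contrapT => nd; apply: (H d).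
  move=> /choice[nx nxP]; exists (fun a h => nx (a, h)) => a' h.
  exact: (nxP (a', h)).
(* the lower left corner of the k-th bad square, whose side is r / 2^k *)
pose sq := fix sq k := if k is j.+1 then
  let b := sq j in let d := nx b (r / 2 ^+ j) in
  b + (d.1%:R * (r / 2 ^+ j.+1) +i* (d.2%:R * (r / 2 ^+ j.+1))) else a.
have halfC j : (r / 2 ^+ j)%:C / 2 = (r / 2 ^+ j.+1)%:C :> C.
  have -> : r / 2 ^+ j = r / 2 ^+ j.+1 *+ 2.
    by rewrite [RHS]mulr2n exprS; field; rewrite expf_neq0 // pnatr_eq0.
  by rewrite rmorphMn /= -mulr_natr mulfK // pnatr_eq0.
have nsq k : ~ negligible_loop e f (sq k) (r / 2 ^+ k)%:C.
  elim: k => [|k IH]; first by rewrite expr0 divr1.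
  have := nxP _ _ IH; rewrite halfC /=; set d := nx _ _; set q := r / _.
  congr (~ negligible_loop e f _ _); rewrite -addrA; congr (_ + _).
  by rewrite -complexiE; case: (d.1); case: (d.2); rewrite ?mul1r ?mul0r; simpc.
have q0 k : 0 <= r / 2 ^+ k by rewrite divr_ge0 ?exprn_ge0 // ltW.
have step (b : bool) (x : R) k : x <= x + b%:R * (r / 2 ^+ k) <= x + r / 2 ^+ k.
  by case: b; rewrite ?mul1r ?mul0r ?addr0 lexx ?lerDl q0.
have [X HX] : exists X, forall k,
    complex.Re (sq k) <= X <= complex.Re (sq k) + r / 2 ^+ k.
  apply: nested_halving => [|k]; first exact: ltW.
  by rewrite /=; case: (sq k) (nx _ _) => u v [d1 d2] /=; apply: step.
have [Y HY] : exists Y, forall k,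
    complex.Im (sq k) <= Y <= complex.Im (sq k) + r / 2 ^+ k.
  apply: nested_halving => [|k]; first exact: ltW.
  by rewrite /=; case: (sq k) (nx _ _) => u v [d1 d2] /=; apply: step.
have [d Hd] := derivable_affine_approx (df (X +i* Y)).
(* Points of the k-th square are within 4 q of the limit point, q being its
   side; the four edges then contribute at most 4 * q * (e / 16 * 4 q) = e q^2. *)
have e16 : 0 < e / 16 by rewrite divr_gt0.
have {Hd} [rho [rho0 Hrho]] := Hd _ e16.
have [k Hk] : exists k, 4 * (r / 2 ^+ k) <= rho.
  pose k := Num.truncn (4 * r / rho); exists k.
  have kn : 4 * r / rho < 2 ^+ k.
    apply: (@lt_le_trans _ _ k.+1%:R); last by rewrite -natrX ler_nat ltn_expl.
    exact: truncnS_gt.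
  rewrite mulrA ler_pdivrMr ?exprn_gt0 // [rho * _]mulrC -ler_pdivrMr //.
  exact: ltW.
apply: (nsq k); exists 0%N => N _.
set q := r / 2 ^+ k in Hk *.
have qn : `|q%:C| = q%:C :> C by exact: rC.
have q4 : (4 * q)%:C = q%:C + q%:C + (q%:C + q%:C) :> C.
  by rewrite -!rmorphD /=; congr (_%:C); ring.
have close w : in_square (sq k) q%:C w -> `|w - (X +i* Y)| <= (4 * q)%:C.
  move=> [s [t [/andP[s0 s1] /andP[t0 t1] ->]]].
  rewrite q4.
  have leq1 (u : C) : 0 <= u -> u <= 1 -> `|u * q%:C| <= q%:C.
    by move=> u0 u1; rewrite normrM qn (ger0_norm u0) ler_piMl // lecR q0.
  have -> : sq k + s * q%:C + t * ('i%R * q%:C) - (X +i* Y) =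
     (s * q%:C + 'i%R * (t * q%:C)) - ((X +i* Y) - sq k) :> C by ring.
  rewrite (le_trans (ler_normB _ _)) // lerD //.
    by rewrite (le_trans (ler_normD _ _)) // lerD ?leq1 // normrM normCi mul1r leq1.
  rewrite [X in `|X|]complexE (le_trans (ler_normD _ _)) // lerD //.
    rewrite ger0_norm; move: (HX k); case: (sq k) => u v /= /andP[? ?].
      by rewrite lecR lerBlDl.
    by rewrite lecR subr_ge0.
  rewrite normrM complexiE normCi mul1r.
  rewrite ger0_norm; move: (HY k); case: (sq k) => u v /= /andP[? ?].
    by rewrite lecR lerBlDl.
  by rewrite lecR subr_ge0.
rewrite (le_trans (@loop_sum_affine_close _ N f (f (X +i* Y)) d (X +i* Y) _ _
  (e / 16 * (4 * q)%:C) _)) //.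
  move=> w /close wc; rewrite (le_trans (Hrho _ (le_trans wc _))) //.
    by rewrite lecR.
  by rewrite ler_wpM2l // ltW.
by rewrite qn q4 le_eqVlt; apply/orP; left; apply/eqP; field.
Qed.

(** For |u| <= 1, |1 + 'i u|^2 = 1 + u^2 is at least 1 and at least 2 u^2, and
4/3 < sqrt 2. *)
Lemma edge_quotient_bounds (u : C) : u \is Num.real -> `|u| <= 1 ->
  1 <= `|1 + 'i%R * u| /\ 4 * `|u| <= 3 * `|1 + 'i%R * u|.
Proof.
move=> ur u1; have n2 : `|1 + 'i%R * u| ^+ 2 = 1 + `|u| ^+ 2.
  by rewrite normC2_rect ?rpred1 // expr1n real_normK.
have uu : `|u| ^+ 2 <= 1 by rewrite expr_le1.
split; rewrite -(@ler_pXn2r _ 2) ?nnegrE ?mulr_ge0 //.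
  by rewrite n2 expr1n lerDl exprn_ge0.
rewrite !exprMn n2 -subr_ge0.
rewrite (_ : _ - _ = 7 * (1 - `|u| ^+ 2) + 2); last by ring.
by rewrite addr_ge0 // mulr_ge0 // subr_ge0.
Qed.

(** Chart-wise, F and G are a section of O(-(m+1)) on P^1.  Write c = G 0 and
H = z^m F, so that z H(z) is close to c for large z.  On each edge of a large
square centred at 0, v H(z), with v the oriented edge, stays in the disc of
centre 2 'i c and radius slightly above 3/2 |c|.  Hence the distance from
the loop sum of H to 8 'i c is at most slightly above 6 |c|, so the loop sums
cannot tend to 0 unless c = 0. *)
Lemma no_section_negative_degree (F G : C -> C) (m : nat) :
  (forall z, derivable F z 1) -> derivable G 0 1 ->
  (forall z, z != 0 -> G z^-1 = z ^+ m.+1 * F z) -> G 0 = 0.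
Proof.
move=> dF dG FG; apply: contrapT => /eqP c0; set c := G 0 in c0 *.
have cp : 0 < `|c| by rewrite normr_gt0.
pose H z := z ^+ m * F z.
have dH (z : C) : derivable H z 1.
  by apply: derivable_mul (dF z); apply: exprn_derivable.
(* 6 |c| + 8 e and the final bound |c| / 2 on the loop sum add up to 7 |c| *)
set e := `|c| / 16; have e0 : 0 < e by rewrite divr_gt0.
have [d [d0 Hd]] : exists r : R, 0 < r /\
    forall z, `|z| <= r%:C -> `|G z - c| <= e.
  have Gc : \forall z \near (0 : C), `|c - G z| <= e.
    have /derivable1_diffP/differentiable_continuous Gc := dG.
    by move/cvgrPdist_le: Gc; apply.
  have [r [r0 Hr]] := near_closed_disc Gc.
  by exists r; split=> // z zr; rewrite distrC; apply: Hr; rewrite subr0.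
pose L : R := d^-1; have L0 : 0 < L by rewrite invr_gt0.
have LC0 : 0 < (L%:C : C) by rewrite ltcR.
have far z : L%:C <= `|z| -> `|z * H z - c| <= e.
  move=> Lz; have z0 : z != 0 by rewrite -normr_gt0 (lt_le_trans LC0).
  rewrite mulrA -exprS -FG //; apply: Hd.
  by rewrite normfV -[d]invrK fmorphV /= lef_pV2 // posrE normr_gt0.
(* The four edges are k L (1 + 'i u), -1 <= u <= 1, for k a fourth root of
   unity; there v / z = 2 'i / (1 + 'i u), which is within 3/2 of 2 'i. *)
have side (u v z k p : C) : u \is Num.real -> `|u| <= 1 -> `|k| = 1 ->
    z = L%:C * k * (1 + 'i%R * u) -> v = 2 * 'i%R * L%:C * k ->
    p = 2 * 'i%R * c ->
    `|v * H z - p| <= 3 / 2 * `|c| + 2 * e.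
  move=> ur u1 k1 zE vE pE; have [b1 b2] := edge_quotient_bounds ur u1.
  have k0 : k != 0 by rewrite -normr_gt0 k1.
  set q := 1 + 'i%R * u in b1 b2 zE.
  have qp : 0 < `|q| by rewrite (lt_le_trans ltr01).
  have q0 : q != 0 by rewrite -normr_gt0.
  have zf : L%:C <= `|z|.
    by rewrite zE !normrM k1 mulr1 (ger0_norm (ltW LC0)) ler_peMr // ltW.
  have -> : v * H z - p = (2 * 'i%R / q) * ((z * H z - c) - 'i%R * u * c).
    by rewrite zE vE pE /q; field; rewrite -/q q0.
  rewrite normrM !normrM normfV normCi mulr1 normr_nat -ler_pdivlMl ?divr_gt0 //.
  rewrite (le_trans (ler_normB _ _)) // !normrM normCi mul1r invf_div.
  have -> : `|q| / 2 * (3 / 2 * `|c| + 2 * e) = e * `|q| + 3 * `|q| / 4 * `|c|.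
    by field.
  rewrite lerD //; first by rewrite (le_trans (far _ zf)) // ler_peMr // ltW.
  by rewrite ler_wpM2r // ler_pdivlMr // mulrC.
have real_s (s : C) : 0 <= s <= 1 -> (2 * s - 1 \is Num.real) /\ `|2 * s - 1| <= 1.
  move=> /andP[s0 s1].
  have sr : 2 * s - 1 \is Num.real.
    by rewrite rpredB ?rpred1 // rpredM ?rpred_nat ?ger0_real.
  split=> //; rewrite real_ler_norml //; apply/andP; split.
    by rewrite lerBrDr addNr mulr_ge0.
  by rewrite lerBlDr -[leRHS]/(2 : C) ler_piMr.
pose a : C := - L%:C - 'i%R * L%:C; pose h : C := 2 * L%:C.
have i2 : 'i%R * 'i%R = -1 :> C by rewrite -expr2 sqrCi.
have big N : `|loop_sum N H a h - 8 * 'i%R * c| <= 6 * `|c| + 8 * e.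
  set p := 2 * 'i%R * c; set B := 3 / 2 * `|c| + 2 * e.
  have -> : loop_sum N H a h - 8 * 'i%R * c =
      (edge_sum N H a h - p) + (edge_sum N H (a + h) ('i%R * h) - p)
      - (edge_sum N H (a + 'i%R * h) h - - p) - (edge_sum N H a ('i%R * h) - - p).
    by rewrite /loop_sum /p; ring.
  have -> : 6 * `|c| + 8 * e = B + B + B + B by rewrite /B; field.
  (* two of the edges enter the loop with the opposite orientation *)
  have flip (x y : C) : `|x * y - - p| = `|(- x) * y - p|.
    by rewrite -normrN; congr `|_|; ring.
  rewrite (le_trans (ler_normB _ _)) // lerD //; last first.
    apply: edge_sum_close => s /real_s[sr s1]; rewrite flip.
    apply: (side (- (2 * s - 1)) _ _ (-1)); rewrite ?rpredN ?normrN ?normr1 //.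
    - by rewrite /a /h; ring: i2.
    - by rewrite /h; ring.
  rewrite (le_trans (ler_normB _ _)) // lerD //; last first.
    apply: edge_sum_close => s /real_s[sr s1]; rewrite flip.
    apply: (side (- (2 * s - 1)) _ _ 'i%R); rewrite ?rpredN ?normrN ?normCi //.
    - by rewrite /a /h; ring: i2.
    - by rewrite /h; ring: i2.
  rewrite (le_trans (ler_normD _ _)) // lerD //.
    apply: edge_sum_close => s /real_s[sr s1].
    apply: (side (2 * s - 1) _ _ (- 'i%R)); rewrite ?normrN ?normCi //.
    - by rewrite /a /h; ring: i2.
    - by rewrite /h; ring: i2.
  apply: edge_sum_close => s /real_s[sr s1].
  apply: (side (2 * s - 1) _ _ 1); rewrite ?normr1 //.
  - by rewrite /a /h; ring: i2.
  - by rewrite /h; ring.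
have c2 : 0 < `|c| / 2 by rewrite divr_gt0.
have hE : h = (2 * L)%:C by rewrite /h !mulr2n !mulrDl !mul1r rmorphD.
have L2 : 0 < 2 * L by rewrite mulr_gt0.
have [N /(_ N (leqnn N)) HN] := goursat dH a L2 c2.
rewrite -hE in HN; have {big} := big N.
have n8 : `|8 * 'i%R * c| = 8 * `|c| by rewrite !normrM normCi mulr1 normr_nat.
have := ler_normB (loop_sum N H a h) (loop_sum N H a h - 8 * 'i%R * c).
rewrite subKr n8 => h1 h2.
have := le_trans h1 (lerD HN h2); rewrite /e.
rewrite (_ : `|c| / 2 + _ = 7 * `|c|); last by field.
by rewrite ler_pM2r // ler_nat.
Qed.

End Goursat.

(** * Substitutions in C[x, y] *)

Section Substitutions.
Variable R : realType.
Local Notation C := (Cplx R).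
Implicit Types (I : set (Cxy R)) (f g h : Cxy R).
HB.instance Definition _ :=
  GRing.RMorphism.copy (@cst R) ((@polyC {poly C}) \o (@polyC C)).

(** Convertible to [subst2], which thereby inherits the morphism laws. *)
Definition substM (g h : Cxy R) : {rmorphism Cxy R -> Cxy R} :=
  horner_eval g \o map_poly (horner_eval h \o map_poly (@cst R)).

Lemma subst2E f g h : subst2 f g h = substM g h f.
Proof. by []. Qed.

Lemma subst_cst c g h : subst2 (cst c) g h = cst c.
Proof.
rewrite subst2E /= -[cst c]/(c%:P%:P) map_polyC /= /horner_eval hornerC.
by rewrite map_polyC hornerC.
Qed.

Lemma subst_X g h : subst2 (vx R) g h = g.
Proof. by rewrite subst2E /= map_polyX /horner_eval hornerX. Qed.

Lemma subst_Y g h : subst2 (vy R) g h = h.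
Proof. by rewrite subst2E /= map_polyC /= /horner_eval hornerC map_polyX hornerX. Qed.

(** Monomials are eigenvectors of rescaling: the weight of x^i y^j is i + j. *)
Lemma rescale_mon (a : C) m : rescale a (mon R m) = cst (a ^+ (m.1 + m.2)) * mon R m.
Proof.
rewrite /rescale subst2E /mon rmorphM !rmorphXn -!subst2E subst_X subst_Y.
by rewrite !exprMn exprD /=; ring.
Qed.

Lemma rescale_lincomb (a : C) n (c : {ffun 'I_n -> C}) (e : 'I_n -> nat * nat) :
  rescale a (lincomb c (@mon R \o e)) =
  lincomb [ffun i => c i * a ^+ ((e i).1 + (e i).2)] (@mon R \o e).
Proof.
rewrite /rescale subst2E /lincomb rmorph_sum; apply: eq_bigr => i _.
rewrite rmorphM -!subst2E subst_cst ffunE rmorphM -mulrA; congr (_ * _).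
exact: rescale_mon.
Qed.

Lemma rescaleB (a : C) f g : rescale a (f - g) = rescale a f - rescale a g.
Proof. by rewrite /rescale !subst2E rmorphB. Qed.

Lemma pullbackM f (p q : {poly C}) : pullback f (p * q) = pullback f p * pullback f q.
Proof. by rewrite /pullback rmorphM hornerM. Qed.

Lemma pullbackD f (p q : {poly C}) : pullback f (p + q) = pullback f p + pullback f q.
Proof. by rewrite /pullback rmorphD hornerD. Qed.

End Substitutions.

(** * Bases modulo an ideal and changes of basis *)

Section Bases.
Variable R : realType.
Local Notation C := (Cplx R).
Implicit Types (I : set (Cxy R)) (f g : Cxy R).

Lemma ideal_sum I (J : finType) (F : J -> Cxy R) : is_ideal I ->
  (forall j, I (F j)) -> I (\sum_j F j).
Proof. by move=> [I0 ID _] IF; elim/big_ind: _ => //; exact: ID. Qed.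

Lemma basis_mod_free I n (b : 'I_n -> Cxy R) (c : {ffun 'I_n -> C}) :
  is_ideal I -> basis_mod I b -> I (lincomb c b) -> c = 0.
Proof.
move=> [I0 ID IM] bI Ic; have [d [_ du]] := bI 0.
have lin0 : lincomb 0 b = 0 by apply: big1 => i _; rewrite ffunE rmorph0 mul0r.
rewrite -(du c); last by rewrite sub0r -mulN1r; apply: IM.
by apply/du; rewrite lin0 subr0.
Qed.

Lemma coord_spec I n (b : 'I_n -> Cxy R) f :
  basis_mod I b -> I (f - lincomb (coord I b f) b).
Proof.
move=> /(_ f)[c [Hc _]].
exact: (@xgetI _ 0 [set c : {ffun 'I_n -> C} | I (f - lincomb c b)] c Hc).
Qed.

Lemma coord_uniq I n (b : 'I_n -> Cxy R) f (c : {ffun 'I_n -> C}) :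
  basis_mod I b -> I (f - lincomb c b) -> coord I b f = c.
Proof.
move=> bI If; have [d [_ du]] := bI f.
by rewrite -(du _ If); symmetry; apply: du; exact: coord_spec.
Qed.

Lemma lincomb_trans I n m (b : 'I_n -> Cxy R) (b' : 'I_m -> Cxy R)
    (M : 'I_m -> {ffun 'I_n -> C}) (c : {ffun 'I_m -> C}) : is_ideal I ->
  (forall k, I (b' k - lincomb (M k) b)) ->
  I (lincomb c b' - lincomb [ffun i => \sum_k c k * M k i] b).
Proof.
move=> idI HM.
suff -> : lincomb c b' - lincomb [ffun i => \sum_k c k * M k i] b =
    \sum_k cst (c k) * (b' k - lincomb (M k) b).
  by apply: ideal_sum => // k; case: idI => _ _; apply.
under [RHS]eq_bigr do rewrite mulrBr; rewrite sumrB; congr (_ - _).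
under [RHS]eq_bigr do rewrite mulr_sumr; rewrite exchange_big /=.
apply: eq_bigr => i _; rewrite ffunE.
under [RHS]eq_bigr do rewrite mulrA -rmorphM.
by rewrite -mulr_suml -rmorph_sum.
Qed.

Definition transition I n (b b' : 'I_n -> Cxy R) : 'M[C]_n :=
  \matrix_(k, i) coord I b (b' k) i.

Lemma expand_in_basis I n m (b : 'I_n -> Cxy R) (b' : 'I_m -> Cxy R) f
    (c : {ffun 'I_m -> C}) : is_ideal I -> basis_mod I b ->
  I (f - lincomb c b') ->
  coord I b f = [ffun i => \sum_k c k * coord I b (b' k) i].
Proof.
move=> idI bI Hc; apply: coord_uniq => //.
have := lincomb_trans c idI (fun k => coord_spec (b' k) bI).
by case: (idI) => _ /(_ _ _ Hc) ID _ /ID; rewrite addrA subrK.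
Qed.

Lemma coord_basis I n (b : 'I_n -> Cxy R) i j : is_ideal I -> basis_mod I b ->
  coord I b (b i) j = (i == j)%:R.
Proof.
move=> idI bI; rewrite (@coord_uniq _ _ _ _ [ffun k => (i == k)%:R]) ?ffunE //.
rewrite /lincomb (bigD1 i) //= ffunE eqxx big1.
  by rewrite rmorph1 mul1r addr0 subrr; case: idI.
by move=> k ki; rewrite ffunE eq_sym (negPf ki) rmorph0 mul0r.
Qed.

(** In dimension n, a spanning family of n elements is a basis: expanding b in b'
and b' in b gives two square matrices that are inverse to each other on one
side, hence on both. *)
Lemma spanning_basis I n (b b' : 'I_n -> Cxy R) :
  is_ideal I -> basis_mod I b ->
  (forall f, exists c : {ffun 'I_n -> C}, I (f - lincomb c b')) -> basis_mod I b'.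
Proof.
move=> idI bI /choice[A HA].
have AM : (\matrix_(i, k) A (b i) k) *m transition I b b' = 1%:M.
  apply/matrixP => i j; rewrite !mxE -(coord_basis _ _ idI bI).
  rewrite (expand_in_basis idI bI (HA (b i))) ffunE.
  by apply: eq_bigr => k _; rewrite !mxE.
have MA := mulmx1C AM.
move=> f; exists (A f); split=> // c Hc.
have e := expand_in_basis idI bI Hc; rewrite (expand_in_basis idI bI (HA f)) in e.
have row_inj (v w : 'rV[C]_n) :
    v *m transition I b b' = w *m transition I b b' -> v = w.
  move=> /(congr1 (mulmx^~ (\matrix_(i, k) A (b i) k))).
  by rewrite -!mulmxA MA !mulmx1.
apply/ffunP => k.
have /row_inj/rowP/(_ k) : (\row_i A f i) *m transition I b b' =
    (\row_i c i) *m transition I b b'.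
  apply/rowP => i; move/ffunP/(_ i): e; rewrite !ffunE !mxE => e.
  under eq_bigr do rewrite !mxE; rewrite e.
  by apply: eq_bigr => l _; rewrite !mxE.
by rewrite !mxE.
Qed.

Lemma transitionK I n (b b' : 'I_n -> Cxy R) : is_ideal I ->
  basis_mod I b -> basis_mod I b' -> transition I b' b *m transition I b b' = 1%:M.
Proof.
move=> idI bI b'I; apply/matrixP => i j.
rewrite !mxE -(coord_basis _ _ idI bI).
rewrite (expand_in_basis idI bI (coord_spec (b i) b'I)) ffunE.
by apply: eq_bigr => k _; rewrite !mxE.
Qed.

(** Coordinates in b' as a function of coordinates in b alone; this form carries
holomorphy from one chart of the Hilbert scheme to another. *)
Lemma coord_change I n (b b' : 'I_n -> Cxy R) f k : is_ideal I ->
  basis_mod I b -> basis_mod I b' ->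
  coord I b' f k = \sum_i coord I b f i * invmx (transition I b b') i k.
Proof.
move=> idI bI b'I; have TK := transitionK idI bI b'I.
have -> : invmx (transition I b b') = transition I b' b.
  have TU := (mulmx1_unit TK).2.
  by rewrite -[LHS]mul1mx -TK mulmxK.
rewrite (expand_in_basis idI b'I (coord_spec f bI)) ffunE.
by apply: eq_bigr => i _; rewrite !mxE.
Qed.

End Bases.

(** * Transverse subschemes and sections *)

Section NoSection.
Variable R : realType.
Local Notation C := (Cplx R).
Implicit Types (I : set (Cxy R)) (f g : Cxy R) (a : C).

(** The exponents of the monomials (x y)^k, k < n. *)
Definition diag n (k : 'I_n) : nat * nat := (val k, val k).

Lemma mon_diag n (k : 'I_n) : (@mon R \o @diag n) k = pi_fib R ^+ k.
Proof. by rewrite /= /mon exprMn. Qed.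

Lemma lincombZ n (c : {ffun 'I_n -> C}) (b : 'I_n -> Cxy R) a :
  cst a * lincomb c b = lincomb [ffun i => a * c i] b.
Proof.
by rewrite /lincomb mulr_sumr; apply: eq_bigr => i _; rewrite ffunE rmorphM mulrA.
Qed.

Lemma pullback_coef n f (q : {poly C}) : (size q <= n)%N ->
  pullback f q = \sum_(i < n) cst q`_i * f ^+ i.
Proof.
move=> qn; rewrite /pullback (@horner_coef_wide _ n); last first.
  by rewrite (leq_trans (size_poly _ _)).
by under eq_bigr do rewrite coef_map.
Qed.

(** The n + 1 powers z^0, ..., z^n are linearly dependent modulo an ideal of
colength n, so some nonzero q of degree <= n in z vanishes on the subscheme.  By
transversality every function is a polynomial in z, and its remainder modulo q
is a combination of z^0, ..., z^(n-1): these n powers span, so they are a basis. *)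
Lemma transverse_diag_basis n I : tHilb n (pi_fib R) I ->
  basis_mod I (@mon R \o @diag n).
Proof.
move=> [[idI [b bI]] tI]; have [I0 ID IM] := idI.
pose M : 'M[C]_(n.+1, n) := \matrix_(k, i) coord I b (pi_fib R ^+ k) i.
have /rowV0Pn[v /sub_kermxP vM v0] : kermx M != 0.
  by rewrite -mxrank_eq0 mxrank_ker -lt0n subn_gt0 ltnS rank_leq_col.
pose q : {poly C} := rVpoly v.
have q0 : q != 0.
  by apply: contra_neq v0 => q0; rewrite -(rVpolyK v) -/q q0 linear0.
have Iq : I (pullback (pi_fib R) q).
  pose cv : {ffun 'I_n.+1 -> C} := [ffun k => v 0 k].
  have -> : pullback (pi_fib R) q = lincomb cv (fun k : 'I_n.+1 => pi_fib R ^+ k).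
    rewrite (@pullback_coef n.+1) ?size_poly //.
    by apply: eq_bigr => k _; rewrite coef_rVpoly_ord ffunE.
  have := lincomb_trans cv idI (fun k : 'I_n.+1 => coord_spec (pi_fib R ^+ k) bI).
  set d := [ffun i => _]; suff -> : d = 0.
    rewrite /lincomb [X in _ - X]big1 ?subr0 // => i _.
    by rewrite ffunE rmorph0 mul0r.
  apply/ffunP => i; rewrite !ffunE; have /rowP/(_ i) := vM; rewrite !mxE => vMi.
  rewrite -[RHS]vMi.
  by apply: eq_bigr => k _; rewrite !mxE ffunE.
apply: (spanning_basis idI bI) => f; have [h [Ifh _]] := tI f.
exists [ffun k : 'I_n => (h %% q)`_k].
have -> : lincomb [ffun k : 'I_n => (h %% q)`_k] (@mon R \o @diag n) =
    pullback (pi_fib R) (h %% q).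
  rewrite (@pullback_coef n); last first.
    by rewrite -ltnS (leq_trans (ltn_modpN0 h q0)) // size_poly.
  by apply: eq_bigr => k _; rewrite mon_diag ffunE.
have -> : f - pullback (pi_fib R) (h %% q) = (f - pullback (pi_fib R) h)
    + pullback (pi_fib R) (h %/ q) * pullback (pi_fib R) q.
  by rewrite {2}(divp_eq h q) pullbackD pullbackM; ring.
by apply: ID => //; apply: IM.
Qed.

(** Holomorphy of a curve is given near each point in the chart of some n-tuple of
monomials, which may vary; the inverse of the transition matrix, by Cramer's
formula, turns it into holomorphy in one prescribed chart. *)
Lemma holo_curve_coord n (F : C -> set (Cxy R)) (e : 'I_n -> nat * nat) :
  (forall t, is_ideal (F t)) -> (forall t, basis_mod (F t) (@mon R \o e)) ->
  holo_curve n F ->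
  forall m k t, derivable (fun u => coord (F u) (@mon R \o e) (mon R m) k) t 1.
Proof.
move=> idF bF hF m k t; have [e' He'] := hF t.
pose T u := transition (F u) (@mon R \o e') (@mon R \o e).
apply: (@near_eq_derivable _ _ _
  (fun u => \sum_i coord (F u) (@mon R \o e') (mon R m) i * invmx (T u) i k)).
  apply: filterS He' => u [bu _].
  by rewrite (coord_change _ _ (idF u) bu (bF u)).
have [_ dt] := nbhs_singleton He'.
apply: derivable_bigsum => i; apply: derivable_mul; first exact: dt.
apply: derivable_invmx => [|k' i'].
  apply: filterS He' => u [bu _].
  exact: (mulmx1_unit (transitionK (idF u) bu (bF u))).2.
by under eq_fun do rewrite mxE; exact: dt.
Qed.

Lemma rescale_ideal I a : is_ideal I -> is_ideal [set f | I (rescale a f)].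
Proof.
move=> [I0 ID IM]; split=> [|f g|h f] /=; rewrite /rescale !subst2E.
- by rewrite rmorph0.
- by rewrite rmorphD; exact: ID.
- by rewrite rmorphM; exact: IM.
Qed.

Lemma rescale_diag_basis I n a : a != 0 ->
  basis_mod I (@mon R \o @diag n) ->
  basis_mod [set f | I (rescale a f)] (@mon R \o @diag n).
Proof.
move=> a0 bI f; have [c [Hc cu]] := bI (rescale a f).
exists [ffun i => c i / a ^+ (i + i)]; split=> [|d] /=; rewrite rescaleB rescale_lincomb.
  congr (I (_ - lincomb _ _)): Hc; apply/ffunP => i.
  by rewrite !ffunE divfK ?expf_neq0.
by move=> /cu ->; apply/ffunP => i; rewrite !ffunE mulfK ?expf_neq0.
Qed.

(** The k-th coordinate of a monomial of weight w is homogeneous of degree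
w - 2k under rescaling, which makes it a section of O(w - 2k). *)
Lemma rescale_coord I n a m (k : 'I_n) : is_ideal I -> a != 0 ->
  basis_mod I (@mon R \o @diag n) ->
  coord [set f | I (rescale a f)] (@mon R \o @diag n) (mon R m) k * a ^+ (k + k) =
  a ^+ (m.1 + m.2) * coord I (@mon R \o @diag n) (mon R m) k.
Proof.
move=> idI a0 bI; have [_ _ IM] := idI.
have /= := coord_spec (mon R m) (rescale_diag_basis a0 bI).
rewrite rescaleB rescale_lincomb rescale_mon; set c := coord _ _ _.
set p := a ^+ (m.1 + m.2); have p0 : p != 0 by rewrite expf_neq0.
move=> /(IM (cst p^-1)); rewrite mulrBr lincombZ.
have -> : cst p^-1 * (cst p * mon R m) = mon R m.
  by rewrite mulrA -[cst _ * cst _](rmorphM (@cst R)) mulVf // rmorph1 mul1r.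
by move=> /(coord_uniq bI) ->; rewrite !ffunE mulVKf.
Qed.

Theorem no_holo_section n (s : P1 R -> fibsub R) :
  (2 <= n)%N -> ~ holo_section n s.
Proof.
case: n => [|[|n]] // _ [sZ sp sh].
have idI zeta : is_ideal (s zeta).2 by have [[]] := sZ zeta.
have bI zeta := transverse_diag_basis (sZ zeta).
have tr0 j (t : C) : tr 1 j (pt j t) != 0.
  rewrite /pt; case: j => /=; last exact: oner_neq0.
  by case: ifPn => t0 /=; rewrite ?oner_neq0 // invr_neq0 // expf_neq0 // invr_eq0.
have idF j (t : C) : is_ideal (in_chart s j t).
  by rewrite /in_chart /chart_ideal [(s _).1]sp; exact: rescale_ideal.
have bF j (t : C) : basis_mod (in_chart s j t) (@mon R \o @diag n.+2).
  by rewrite /in_chart /chart_ideal [(s _).1]sp; exact: rescale_diag_basis.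
pose a j m k (t : C) : C :=
  coord (in_chart s j t) (@mon R \o @diag n.+2) (mon R m) k.
have da j m k t : derivable (a j m k) t 1 by exact: holo_curve_coord.
(* m is the exponent of x or of y; k >= 1 makes 1 - 2k negative *)
have glue m (k : 'I_n.+2) (z : C) : val k != 0%N -> z != 0 -> (m.1 + m.2 = 1)%N ->
    a true m k z^-1 = z ^+ (k + k).-1 * a false m k z.
  move=> k0 z0 m1; have zi : pt true z^-1 = Some z.
    by rewrite /pt (negPf (invr_neq0 z0)) invrK.
  have cE j t : a j m k t * tr 1 j (pt j t) ^+ (k + k) =
      tr 1 j (pt j t) * coord (s (pt j t)).2 (@mon R \o @diag n.+2) (mon R m) k.
    rewrite /a /in_chart /chart_ideal [(s _).1]sp.
    by rewrite (rescale_coord _ _ (idI _) (tr0 j t) (bI _)) m1.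
  have := cE false z; rewrite expr1n mulr1 mul1r => ->.
  have := cE true z^-1; rewrite zi /= expr1.
  set A := a _ _ _ _; set Co := coord _ _ _ _.
  have -> : (k + k = (k + k).-1.+1)%N by rewrite prednK // addn_gt0 lt0n k0.
  move=> /(congr1 ( *%R^~ (z ^+ (k + k).-1.+1))).
  rewrite -mulrA -exprMn mulVf // expr1n mulr1 => ->.
  by rewrite exprS mulrAC mulKf // mulrC.
have const m (k : 'I_n.+2) : (m.1 + m.2 = 1)%N -> val k != 0%N -> a true m k 0 = 0.
  move=> m1 k0.
  apply: (@no_section_negative_degree _ (a false m k) (a true m k) (k + k).-2).
  - exact: da.
  - exact: da.
  - move=> z z0; rewrite glue //; congr (_ ^+ _ * _).
    by move: k0; rewrite /=; case: (nat_of_ord k) => // l _; rewrite addnS addSn.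
pose I := in_chart s true 0; have idI0 : is_ideal I by exact: idF.
have bI0 : basis_mod I (@mon R \o @diag n.+2) by exact: bF.
have const_mod m : (m.1 + m.2 = 1)%N -> I (mon R m - cst (a true m ord0 0)).
  move=> m1; have := coord_spec (mon R m) bI0; rewrite /lincomb (bigD1 ord0) //.
  rewrite big1; last first.
    by move=> k k0; rewrite [coord _ _ _ _]const // rmorph0 mul0r.
  by rewrite mon_diag expr0 mulr1 [X in _ - X]addr0.
have [x0 xI] : exists x0, I (vx R - cst x0).
  exists (a true (1, 0)%N ord0 0); rewrite -[vx R]mulr1.
  exact: (const_mod (1, 0)%N).
have [y0 yI] : exists y0, I (vy R - cst y0).
  exists (a true (0, 1)%N ord0 0); rewrite -[vy R]mul1r.
  exact: (const_mod (0, 1)%N).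
have [_ ID IM] := idI0.
(* x y - x0 y0 would be a relation between the basis elements 1 and z *)
have xyI : I (pi_fib R - cst (x0 * y0)).
  rewrite rmorphM (_ : _ - _ = vy R * (vx R - cst x0) + cst x0 * (vy R - cst y0)).
    by apply: ID; apply: IM.
  by rewrite /pi_fib; ring.
pose k1 : 'I_n.+2 := lift ord0 ord0.
pose c : {ffun 'I_n.+2 -> C} := [ffun k =>
  if k == k1 then 1 else if k == ord0 then - (x0 * y0) else 0].
have Ic : I (lincomb c (@mon R \o @diag n.+2)).
  have -> // : lincomb c (@mon R \o @diag n.+2) = pi_fib R - cst (x0 * y0).
  rewrite /lincomb (bigD1 k1) // (bigD1 ord0) // big1 => [|k /andP[kk1 k0]].
    rewrite !mon_diag !ffunE !eqxx rmorph1 rmorphN expr0 expr1 mulr1 mul1r.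
    by rewrite [X in _ + X = _]addr0.
  by rewrite ffunE (negPf kk1) (negPf k0) rmorph0 mul0r.
have /ffunP/(_ k1) := basis_mod_free idI0 bI0 Ic.
by rewrite !ffunE eqxx => /eqP; rewrite oner_eq0.
Qed.

End NoSection.

Theorem mainTheorem12 (R : realType) (n : nat) (hn : (2 <= n)%N) :
  ~ (exists s : P1 R -> fibsub R, holo_section n s) /\
  twistor_lines R n = set0.
Proof.
have no s : ~ holo_section n s := @no_holo_section R n s hn.
split=> [[s /no]|] //.
by rewrite -subset0 => s [/no].
Qed.
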